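(* Let $\mathcal P$ be a (possibly non-convex) polyhedron. If $\mathcal P$ is tight, then $\mathcal P$ has a vertex unfolding.
   Context: A polyhedron $\mathcal P$ is called tight if no two non-triangular faces of $\mathcal P$ share a vertex. A vertex unfolding of $\mathcal P$ is obtained by cutting the surface of $\mathcal P$ along edges and laying all faces of $\mathcal P$ (each congruently) in the plane so that the result is a single connected piece without overlap, where two faces of the piece may be joined either along a common edge or only at a common vertex (so the resulting piece may have disconnected interior). *)

(* Defs.v *)
From mathcomp Require Import all_boot all_order all_algebra.
From mathcomp Require Import all_classical all_reals all_analysis.
Set Implicit Arguments.
Unset Strict Implicit.
Unset Printing Implicit Defensive.
Import Order.TTheory GRing.Theory Num.Theory.
Import numFieldNormedType.Exports.
Local Open Scope classical_set_scope.
Local Open Scope ring_scope.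

(* The library norm on row vectors is the sup norm (it induces the topology
   and the notion of boundedness used below); congruence needs the Euclidean
   distance. *)
Definition dotp (R : realType) (n : nat) (u v : 'rV[R]_n) : R :=
  \sum_(i < n) u ord0 i * v ord0 i.

Definition edist (R : realType) (n : nat) (u v : 'rV[R]_n) : R :=
  Num.sqrt (dotp (u - v) (u - v)).

Definition segment (R : realType) (n : nat) (p q : 'rV[R]_n)
    : set 'rV[R]_n :=
  [set x | exists2 t : R, 0 <= t <= 1 & x = (1 - t) *: p + t *: q].

(* Raw data of a polygonal surface in 3-space.  Each face is given by its
   boundary walk (a cyclic sequence of vertices) and by an equation
   dotp (face_normal f) x = face_offset f of its supporting plane; the
   conditions making this data a polyhedron are in [is_polyhedron]. *)
Record polygonal_complex (R : realType) := PolygonalComplex {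
  vertex : finType;
  face : finType;
  pos : vertex -> 'rV[R]_3;
  face_walk : face -> seq vertex;
  face_normal : face -> 'rV[R]_3;
  face_offset : face -> R }.

Section PolygonalComplex.
Context (R : realType) (P : polygonal_complex R).
Implicit Types (f g : face P) (v w : vertex P) (e : {set vertex P}).

(* An edge is the unordered pair of two cyclically consecutive vertices. *)
Definition edges_of f : {set {set vertex P}} :=
  [set [set v; next (face_walk f) v]%SET | v in face_walk f]%SET.

Definition edge_segment e : set 'rV[R]_3 :=
  [set x | exists v w, e = [set v; w]%SET /\ segment (pos v) (pos w) x].

Definition face_plane f : set 'rV[R]_3 :=
  [set x | dotp (face_normal f) x = face_offset f].

Definition face_boundary f : set 'rV[R]_3 :=
  [set x | exists2 e, e \in edges_of f & edge_segment e x].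

(* The closed plane region bounded by the boundary walk: the boundary together
   with the bounded connected components of its complement in the plane. *)
Definition face_region f : set 'rV[R]_3 :=
  face_boundary f `|`
  [set x | (face_plane f `\` face_boundary f) x /\
           bounded_set
             (connected_component (face_plane f `\` face_boundary f) x)].

Definition simple_polygon f : Prop :=
  [/\ uniq (face_walk f), (2 < size (face_walk f))%N &
      forall e e', e \in edges_of f -> e' \in edges_of f -> e != e' ->
      forall x, edge_segment e x -> edge_segment e' x ->
      exists v, [/\ v \in e, v \in e' & x = pos v]].

Definition share_edge f g : bool :=
  [exists e : {set vertex P}, (e \in edges_of f) && (e \in edges_of g)].

Definition share_edge_at v f g : bool :=
  [exists e : {set vertex P}, [&& v \in e, e \in edges_of f & e \in edges_of g]].

(* A polyhedron: a nonempty connected closed 2-manifold embedded in 3-space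
   and made of finitely many planar simple polygons.  No convexity, genus or
   general-position requirement is made (straight angles and coplanar
   neighbours are allowed).
   In [poly_link]: around a vertex each incident face has two edges and each
   edge two faces, so connectedness means that the incident faces form a
   single cycle. *)
Record is_polyhedron : Prop := IsPolyhedron {
  poly_nonempty : exists f : face P, True;
  poly_pos_inj : injective (@pos R P);
  poly_vertex_used : forall v, exists f, v \in face_walk f;
  poly_simple : forall f, simple_polygon f;
  poly_normal_neq0 : forall f, face_normal f != 0;
  poly_planar : forall f v, v \in face_walk f -> face_plane f (pos v);
  poly_two_faces : forall f e, e \in edges_of f ->
    #|[set g | e \in edges_of g]%SET| = 2%N;
  poly_link : forall v f g, v \in face_walk f -> v \in face_walk g ->
    connect (share_edge_at v) f g;
  poly_connected : forall f g, connect share_edge f g;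
  poly_embedded : forall f g, f != g -> forall x,
    face_region f x -> face_region g x ->
    (exists v, [/\ v \in face_walk f, v \in face_walk g & x = pos v]) \/
    (exists e, [/\ e \in edges_of f, e \in edges_of g & edge_segment e x]) }.

Definition triangular f : bool := size (face_walk f) == 3%N.

Definition tight : Prop :=
  forall f g, f != g -> ~~ triangular f -> ~~ triangular g ->
  forall v, ~~ ((v \in face_walk f) && (v \in face_walk g)).

(* [phi f] places the face [f] in the plane; only its values on
   [face_region f] matter.  The cut edges are the edges along which the two
   incident faces are not joined in the placement. *)
Section Placement.
Variable phi : face P -> 'rV[R]_3 -> 'rV[R]_2.

Definition joined_along_edge f g : Prop :=
  exists e, [/\ e \in edges_of f, e \in edges_of g &
                forall x, edge_segment e x -> phi f x = phi g x].

Definition joined_at_vertex f g : Prop :=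
  exists v, [/\ v \in face_walk f, v \in face_walk g &
                phi f (pos v) = phi g (pos v)].

Record is_vertex_unfolding : Prop := IsVertexUnfolding {
  unfolding_congruent : forall f x y, face_region f x -> face_region f y ->
    edist (phi f x) (phi f y) = edist x y;
  unfolding_no_overlap : forall f g, f != g ->
    interior (phi f @` face_region f) `&` interior (phi g @` face_region g)
    = set0;
  unfolding_connected : forall f g,
    connect (fun f' g' =>
      `[< joined_along_edge f' g' \/ joined_at_vertex f' g' >]) f g }.
End Placement.

Definition has_vertex_unfolding : Prop :=
  exists phi : face P -> 'rV[R]_3 -> 'rV[R]_2, is_vertex_unfolding phi.

End PolygonalComplex.

Arguments is_polyhedron {R} P.
Arguments tight {R} P.
Arguments has_vertex_unfolding {R} P.

(* Main.v *)
Require Import Defs.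
From mathcomp Require Import all_boot all_order all_algebra.
From mathcomp Require Import all_classical all_reals all_analysis.
From mathcomp Require Import ring lra.
Set Implicit Arguments.
Unset Strict Implicit.
Unset Printing Implicit Defensive.

(* Choose in every face two vertices that are extreme in opposite directions of
   its plane: in a triangle any two vertices will do, in another face the pair is
   fixed once and for all.  Each face becomes an arc joining its two vertices.  If
   these arcs can be chosen so as to form a trail through all the faces, the faces
   can be placed one after the other in consecutive parallel strips, touching at
   the vertices of the trail.

   By tightness, the triangles are connected through shared edges even without the
   other faces.  Peeling off triangles one at a time, the degrees of all vertices
   can be made even, except perhaps on a last triangle; doubling that triangle
   repairs the parity there.  A maximal trail is then closed, hence meets no
   unused arc, and if it misses a face then some triangle on it shares an edge
   with a triangle off it; exchanging the two shared vertices prolongs the trail.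
   The trail so obtained uses every arc, and the copy of the doubled triangle can
   be dropped from it. *)

(** * Trails *)

Lemma connect_exit (I : finType) (r : rel I) (S : pred I) x y :
  connect r x y -> x \in S -> y \notin S ->
  exists a b, [/\ a \in S, b \notin S & r a b].
Proof.
case/connectP => l; elim: l x => [|z l IH] x /= => [_ ->|/andP[rxz pl] yE] xS yS.
  by rewrite xS in yS.
by have [zS|zS] := boolP (z \in S); [exact: IH pl yE zS yS|exists x, z].
Qed.

Section Trails.
Context (V E : finType).
Implicit Types (p : E -> V * V) (d : V * V) (s : seq E).

(** The boundary of an arc modulo 2; a loop contributes nothing. *)
Definition chi d (v : V) : bool := (v == d.1) (+) (v == d.2).

Definition odd_deg p (v : V) : bool := \big[addb/false]_e chi (p e) v.

Definition upd p e d : E -> V * V := fun x => if x == e then d else p x.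

Lemma upd_id p e d : upd p e d e = d.
Proof. by rewrite /upd eqxx. Qed.

Lemma upd_neq p e d x : x != e -> upd p e d x = p x.
Proof. by rewrite /upd => /negPf->. Qed.

Lemma odd_deg_upd p e d v :
  odd_deg (upd p e d) v = odd_deg p v (+) chi (p e) v (+) chi d v.
Proof.
rewrite /odd_deg (bigD1 e) //= [in RHS](bigD1 e) //= upd_id.
rewrite (eq_bigr (fun x => chi (p x) v)) => [|x xe]; last by rewrite upd_neq.
by move: (bigop _ _ _) => b; case: (chi d v); case: (chi (p e) v); case: b.
Qed.

Lemma sum_chi d : \big[addb/false]_v chi d v = false.
Proof.
have sum1 (a : V) : \big[addb/false]_v (v == a) = true.
  by rewrite (bigD1 a) //= eqxx big1 // => v /negPf.
by rewrite big_split /= !sum1.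
Qed.

(** Handshake lemma modulo 2: after exchanging the sums, each arc has an even boundary. *)
Lemma sum_odd_deg p : \big[addb/false]_v odd_deg p v = false.
Proof. by rewrite exchange_big big1 // => e _; rewrite sum_chi. Qed.

Fixpoint trail p u s w : bool :=
  if s is e :: s' then ((p e).1 == u) && trail p (p e).2 s' w else u == w.

Lemma trail_cat p u s1 s2 w v : trail p u s1 v -> trail p v s2 w ->
  trail p u (s1 ++ s2) w.
Proof.
by elim: s1 u => [|e s1 IH] u /= => [/eqP->//|/andP[-> h] /(IH _ h)].
Qed.

Lemma trail_split p u s1 e s2 w : trail p u (s1 ++ e :: s2) w ->
  trail p u s1 (p e).1 /\ trail p (p e).2 s2 w.
Proof.
elim: s1 u => [|f s1 IH] u /= => [/andP[/eqP-> ->]|/andP[-> /IH[-> ->]]] //.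
Qed.

Lemma eq_in_trail p p' u s w : {in s, p =1 p'} -> trail p u s w = trail p' u s w.
Proof.
elim: s u => //= e s IH u h; rewrite h ?mem_head // IH // => x xs.
by apply: h; rewrite inE xs orbT.
Qed.

(** The sum telescopes: at each inner vertex of the walk, the end of one arc cancels the start of
    the next. *)
Lemma trail_parity p u s w v : trail p u s w ->
  \big[addb/false]_(e <- s) chi (p e) v = (v == u) (+) (v == w).
Proof.
elim: s u => [|e s IH] u /=; first by move/eqP->; rewrite big_nil addbb.
case/andP => /eqP<- h; rewrite big_cons (IH _ h) /chi.
by case: (v == _); case: (v == _); case: (v == _).
Qed.

Lemma trail_sorted p u s w : trail p u s w ->
  sorted (fun e f => (p e).2 == (p f).1) s.
Proof.
case: s => //= e s /andP[_]; elim: s e => //= f s IH e /andP[h /IH->].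
by rewrite eq_sym h.
Qed.

(** * Choices of arcs with even degrees, and growing trails *)

Section Triangles.
(** Abstract form of a tight polyhedron: [T] lists the vertices of a triangle, [d0] fixes the arc of
    any other face. Being abstract, it allows two elements of [E] with the same [T], that is, a
    doubled triangle. *)
Variables (tri : pred E) (T : E -> seq V) (d0 : E -> V * V).

Definition swap d : V * V := (d.2, d.1).

Definition admissible e d : bool :=
  if tri e then [&& d.1 != d.2, d.1 \in T e & d.2 \in T e]
  else (d == d0 e) || (d == swap (d0 e)).

(** Asking only for two common vertices makes a triangle adjacent to its own copy. *)
Definition edge_adjacent t t' : bool :=
  [&& tri t, tri t' &
    [exists a, exists b, [&& a != b, a \in T t, b \in T t, a \in T t' & b \in T t']]].

Hypothesis T_triple : forall e, tri e -> uniq (T e) /\ size (T e) = 3.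
Hypothesis d0_neq : forall e, ~~ tri e -> (d0 e).1 != (d0 e).2.
Hypothesis d0_disjoint : forall e f v, ~~ tri e -> ~~ tri f ->
  chi (d0 e) v -> chi (d0 f) v -> e = f.
Hypothesis d0_covered : forall e v, ~~ tri e -> chi (d0 e) v ->
  exists2 t, tri t & v \in T t.
Hypothesis tri_connected : forall t t', tri t -> tri t' -> connect edge_adjacent t t'.

Lemma chi_swap d v : chi (swap d) v = chi d v.
Proof. by rewrite /chi addbC. Qed.

Lemma admissible_swap e d : admissible e d -> admissible e (swap d).
Proof.
rewrite /admissible /swap; case: ifP => _; first by rewrite eq_sym => /and3P[-> -> ->].
by case: d (d0 e) => [a b] [a' b'] /=; rewrite orbC => /orP[]/eqP[-> ->]; rewrite !eqxx ?orbT.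
Qed.

Lemma admissible_neq e d : admissible e d -> d.1 != d.2.
Proof.
rewrite /admissible; case: ifP => [_ /and3P[]//|/negbT/d0_neq h].
by case/orP => /eqP-> //=; rewrite eq_sym.
Qed.

Lemma admissible_chi e d v : ~~ tri e -> admissible e d -> chi d v = chi (d0 e) v.
Proof.
by rewrite /admissible => /negPf-> /orP[]/eqP->//; rewrite chi_swap.
Qed.

Lemma admissible_chi_tri e d v : tri e -> admissible e d -> chi d v -> v \in T e.
Proof.
rewrite /admissible /chi => -> /and3P[_ h1 h2].
by case: eqVneq => [->//|_]; case: eqVneq => [->|].
Qed.

Lemma admissible_upd p e d : (forall x, admissible x (p x)) -> admissible e d ->
  forall x, admissible x (upd p e d x).
Proof. by move=> hp hd x; rewrite /upd; case: eqP => [->|]. Qed.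

Lemma exists_third t a b : tri t -> a != b -> a \in T t -> b \in T t ->
  exists c, [/\ c != a, c != b & T t =i [:: a; b; c]].
Proof.
move=> /T_triple[uT sT] ab aT bT.
have bT' : b \in rem a (T t) by rewrite mem_rem_uniq // !inE eq_sym ab.
have := perm_trans (perm_to_rem aT) (etrans (perm_cons a _ _) (perm_to_rem bT')).
have : size (rem b (rem a (T t))) = 1 by rewrite !size_rem // sT.
case: (rem b _) => [|c []] // _ pT; exists c; move: (perm_uniq pT); rewrite uT /= !inE.
rewrite negb_or ab andbT => /esym/andP[ac bc]; split; rewrite 1?eq_sym //.
exact: perm_mem.
Qed.

(** An even subset of three vertices is empty or a pair. One side taken twice gives the empty set;
    the two sides through the third vertex give a pair. *)
Lemma two_pairs t (D : V -> bool) : tri t -> \big[addb/false]_v D v = false ->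
  (forall v, D v -> v \in T t) ->
  exists d d', [/\ admissible t d, admissible t d' &
                   forall v, chi d v (+) chi d' v = D v].
Proof.
move=> tt sD DT; have [uT sT] := T_triple tt.
have eT : exists x y z, T t = [:: x; y; z].
  by case: (T t) sT => [|x [|y [|z [|? ?]]]] //= _; exists x, y, z.
case: eT => x [y [z eT]]; move: uT; rewrite eT /= !inE negb_or.
case/andP=> /andP[xy xz] /andP[yz _].
have D3 : D x (+) D y (+) D z = false.
  rewrite -sD (bigD1 x) //= (bigD1 y) //=; last by rewrite eq_sym.
  rewrite (bigD1 z) /=; last by rewrite eq_sym xz eq_sym yz.
  rewrite big1 => [|v]; first by rewrite addbF addbA.
  case/andP=> /andP[vx vy] vz; apply/negbTE/negP => /DT.
  by rewrite eT !inE (negPf vx) (negPf vy) (negPf vz).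
have adm a b : a != b -> a \in [:: x; y; z] -> b \in [:: x; y; z] -> admissible t (a, b).
  by rewrite /admissible tt eT => /= -> -> ->.
have mx : x \in [:: x; y; z] by rewrite inE eqxx.
have my : y \in [:: x; y; z] by rewrite !inE eqxx orbT.
have mz : z \in [:: x; y; z] by rewrite !inE eqxx !orbT.
have axy := adm _ _ xy mx my; have axz := adm _ _ xz mx mz.
have ayz := adm _ _ yz my mz.
have out v : v != x -> v != y -> v != z -> D v = false.
  move=> vx vy vz; apply/negbTE/negP => /DT.
  by rewrite eT !inE (negPf vx) (negPf vy) (negPf vz).
have yx : y == x = false by rewrite eq_sym (negPf xy).
have zx : z == x = false by rewrite eq_sym (negPf xz).
have zy : z == y = false by rewrite eq_sym (negPf yz).
suff [d [d' [ad ad' hd]]] : exists d d', [/\ admissible t d, admissible t d' &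
    [/\ chi d x (+) chi d' x = D x, chi d y (+) chi d' y = D y,
       chi d z (+) chi d' z = D z & forall v, v \notin T t -> chi d v (+) chi d' v = false]].
  exists d, d'; split=> // v; case: hd => hx hy hz ho.
  have [->//|vx] := eqVneq v x; have [->//|vy] := eqVneq v y.
  have [->//|vz] := eqVneq v z; rewrite ho ?out //.
  by rewrite eT !inE (negPf vx) (negPf vy) (negPf vz).
have no d d' v : admissible t d -> admissible t d' -> v \notin T t ->
    chi d v (+) chi d' v = false.
  move=> ad ad' nv; rewrite /= (_ : chi d v = false); last first.
    by apply: contraNF nv => /(admissible_chi_tri tt ad).
  by apply: contraNF nv => /(admissible_chi_tri tt ad').
have at_xyz := (eqxx, negPf xy, negPf xz, negPf yz, yx, zx, zy).
case: (D x) (D y) (D z) D3 => [] [] [] //= _.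
- exists (x, z), (y, z); split=> //; split; try by rewrite /chi /= !at_xyz.
  by move=> v; apply: no.
- exists (x, y), (y, z); split=> //; split; try by rewrite /chi /= !at_xyz.
  by move=> v; apply: no.
- exists (x, y), (x, z); split=> //; split; try by rewrite /chi /= !at_xyz.
  by move=> v; apply: no.
- exists (x, y), (x, y); split=> //; split; try by rewrite addbb.
  by move=> v; apply: no.
Qed.

Lemma odd_deg_swap p e v : odd_deg (upd p e (swap (p e))) v = odd_deg p v.
Proof. by rewrite odd_deg_upd chi_swap -addbA addbb addbF. Qed.

(** Peeling, by induction on the number of triangles outside [S]. A triangle [t'] outside [S] that
    shares [a], [b] with a triangle of [S] is first added to [S]; afterwards its arc is reset so as
    to make its third vertex [c] even. The vertices [a] and [b] may stay odd, being on a triangle of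
    [S]. *)
Lemma clear_odd_outside t1 (S : {set E}) : tri t1 -> t1 \in S -> {in S, forall t, tri t} ->
  exists2 p, (forall e, admissible e (p e)) &
    forall v, odd_deg p v -> exists2 t, t \in S & v \in T t.
Proof.
move=> tt1; have [n] := ubnP #|[pred t | tri t & t \notin S]|.
elim: n S => // n IH S leS t1S trS.
have [/existsP[t0 /andP[tt0 t0S]]|] := boolP [exists t, tri t && (t \notin S)]; last first.
  (* All triangles are in [S]: any admissible choice will do, since every end of an arc lies on some
     triangle. *)
  rewrite negb_exists => /forallP allS.
  pose p e : V * V := if tri e then (if T e is [:: x, y & _] then (x, y) else d0 e) else d0 e.
  have admp e : admissible e (p e).
    rewrite /admissible /p; case te: (tri e); last by rewrite eqxx.
    have [] := T_triple te; case: (T e) => [|x [|y l]] //=.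
    by rewrite !inE negb_or ?eqxx => /andP[/andP[-> _] _] _; rewrite ?eqxx ?orbT.
  exists p => // v ov.
  have inS e : tri e -> e \in S by move=> te; have := allS e; rewrite te negbK.
  have /existsP[e ce] : [exists e, chi (p e) v].
    apply: contraTT ov; rewrite negb_exists => /forallP h.
    by rewrite /odd_deg big1 // => e _; apply/negbTE.
  have [te|nte] := boolP (tri e).
    by exists e; [exact: inS|exact: admissible_chi_tri ce].
  by have [|t tt vt] := d0_covered nte (v := v);
    [rewrite -(admissible_chi _ nte (admp e))|exists t; rewrite ?inS].
have [t [t' [tS t'S att']]] :=
  connect_exit (S := mem S) (tri_connected tt1 tt0) t1S t0S.
have /and3P[tt tt' /existsP[a /existsP[b /and5P[ab aT bT aT' bT']]]] := att'.
have [|||p admp hp] := IH (t' |: S).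
- move: leS; rewrite ltnS; apply: leq_trans; apply: proper_card; apply/properP; split.
    by apply/fintype.subsetP => e; rewrite !inE negb_or => /and3P[-> _ ->].
  by exists t'; rewrite !inE ?tt' ?t'S // eqxx andbF.
- by rewrite !inE t1S orbT.
- by move=> e; rewrite !inE => /predU1P[->//|/trS].
have [c [ca cb eT']] := exists_third tt' ab aT' bT'.
(* The test is the parity at [c] of the arcs other than that of [t']; of the two candidates, only
   [a - c] ends at [c]. *)
pose d := if odd_deg p c (+) chi (p t') c then (a, c) else (a, b).
have admd : admissible t' d.
  by rewrite /d /admissible tt'; case: ifP => _ /=; rewrite ?aT' ?bT' ?ab //
    eq_sym ca eT' !inE eqxx !orbT.
exists (upd p t' d); first exact: admissible_upd.
move=> v; have [->|vc] := eqVneq v c.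
  by rewrite odd_deg_upd /d; case: (odd_deg p c (+) _); rewrite /chi /= ?eqxx ?(negPf ca) ?(negPf cb).
have [->|va] := eqVneq v a; first by exists t.
have [->|vb] := eqVneq v b; first by exists t.
have vT' : v \notin T t' by rewrite eT' !inE negb_or va negb_or vb.
have nchi d1 : admissible t' d1 -> chi d1 v = false.
  by move=> ad1; apply: contraNF vT'; exact: admissible_chi_tri.
rewrite odd_deg_upd !nchi // !addbF => /hp[e]; rewrite !inE => /predU1P[->|eS vT].
  by rewrite (negPf vT').
by exists e.
Qed.

(** After peeling down to [t1], the odd vertices of the arcs other than those of [t1] and [t2] form
    a subset of [T t1], even by the handshake lemma. The two copies cancel it by [two_pairs]; a
    single arc with distinct ends could not do so for the empty set. *)
Lemma even_assignment t1 t2 : tri t1 -> tri t2 -> t1 != t2 -> T t1 = T t2 ->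
  exists2 p, (forall e, admissible e (p e)) & forall v, odd_deg p v = false.
Proof.
move=> tt1 tt2 t12 eT.
have [|||p admp hp] := @clear_odd_outside t1 [set t1]%SET; rewrite ?inE //.
  by move=> e; rewrite inE => /eqP->.
have [||d [d' [admd admd' hd]]] :=
    @two_pairs t1 (fun v => odd_deg p v (+) chi (p t1) v (+) chi (p t2) v) tt1.
- by rewrite 2!big_split /= sum_odd_deg !sum_chi.
- move=> v /=; have [/hp[e /set1P-> vT _ //]|_ /=] := boolP (odd_deg p v).
  have [/(admissible_chi_tri tt1 (admp t1))//|_ /=] := boolP (chi (p t1) v).
  by rewrite eT; apply: admissible_chi_tri.
have admd2 : admissible t2 d' by move: admd'; rewrite /admissible tt1 tt2 eT.
exists (upd (upd p t1 d) t2 d'); first by do 2!apply: admissible_upd => //.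
move=> v; rewrite !odd_deg_upd upd_neq 1?eq_sym //.
have := hd v; case: (chi d v); case: (chi d' v); case: (odd_deg p v);
  by case: (chi (p t1) v); case: (chi (p t2) v).
Qed.

(** Evenness concerns all arcs, on the trail or off it. The choice [p] is a parameter because it
    changes as the trail grows. *)
Definition even_trail p u s w : Prop :=
  [/\ forall e, admissible e (p e), forall v, odd_deg p v = false,
      uniq s & trail p u s w].

Lemma even_trail_prepend p u s w e : even_trail p u s w -> e \notin s -> chi (p e) u ->
  exists p' u', even_trail p' u' (e :: s) w.
Proof.
move=> [admp evp us tr] es ceu.
have [eu|neu] := eqVneq (p e).2 u.
  by exists p, (p e).1; split; rewrite //= ?es // eqxx eu.
have eu : (p e).1 = u.
  by move: ceu; rewrite /chi eq_sym [u == _]eq_sym (negPf neu) addbF => /eqP.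
exists (upd p e (swap (p e))), (p e).2; split => /=.
- by apply: admissible_upd => //; exact: admissible_swap.
- by move=> v; rewrite odd_deg_swap.
- by rewrite es.
- rewrite upd_id eqxx /= eu -(@eq_in_trail p) // => x xs.
  by rewrite upd_neq //; apply: contraNneq es => <-.
Qed.

(** All arcs at [u] are on the trail, so its degree at [u] is even, whereas an open trail has odd
    degree at its start. *)
Lemma even_trail_closed p u s w : even_trail p u s w ->
  (forall e, e \notin s -> chi (p e) u = false) -> w = u.
Proof.
move=> [_ evp us tr] nou; have := evp u; rewrite /odd_deg (bigID (mem s)) /=.
rewrite [X in _ (+) X]big1 // addbF -big_uniq //= (trail_parity _ tr) eqxx /=.
by move/negbFE/eqP.
Qed.

Lemma even_trail_rot p u s f : even_trail p u s u -> f \in s ->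
  exists2 s', perm_eq s (f :: s') & even_trail p (p f).1 (f :: s') (p f).1.
Proof.
move=> [admp evp us tr] fs; case/splitPr: fs us tr => s1 s2 us tr.
have perm : perm_eq (s1 ++ f :: s2) (f :: s2 ++ s1) by rewrite perm_catC.
exists (s2 ++ s1) => //; split => //; first by rewrite -(perm_uniq perm).
by have [h1 h2] := trail_split tr; rewrite /= eqxx (trail_cat h2 h1).
Qed.

(* Write [a], [b] for the vertices shared by [t] and [t'], with arcs [a - c] and
   [b - d].  Replacing them by [b - c] and [a - d] keeps all parities, and turns
   the trail into [b - c - ... - a - d], one arc longer. *)
Lemma even_trail_exchange p u t s t' : even_trail p u (t :: s) u ->
  t' \notin t :: s -> edge_adjacent t t' ->
  (forall v, chi (p t) v -> chi (p t') v = false) ->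
  exists p' u' s' w', even_trail p' u' s' w' /\ size s' = (size s).+2.
Proof.
move=> [admp evp us /= /andP[/eqP pt tr]] t's.
case/and3P=> tt tt' /existsP[a0 /existsP[b0 /and5P[ab0 aT0 bT0 aT0' bT0']]] disj.
move: (admp t) (admp t'); rewrite /admissible tt tt'.
case e1: (p t) pt tr disj => [x y] /= <- tr disj.
case e2: (p t') disj => [x' y'] disj /= => /and3P[xy xT yT] /and3P[xy' xT' yT'].
have [z [zx zy eT]] := exists_third tt xy xT yT.
have [z' [zx' zy' eT']] := exists_third tt' xy' xT' yT'.
have xy_off v : v \in [:: x; y] -> v \notin [:: x'; y'].
  rewrite !inE => hv; have := disj v; rewrite /chi /=.
  have -> : (v == x) (+) (v == y).
    by case/orP: hv => /eqP->; rewrite eqxx ?(negPf xy) // eq_sym (negPf xy).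
  move=> /(_ isT); case: eqVneq => [->|_]; case: eqVneq => // exy'.
  by rewrite exy' eqxx in xy'.
have split3 (a b c v : V) : (v \in [:: a; b; c]) = (v \in [:: a; b]) || (v == c).
  by rewrite !inE orbA.
(* The arcs have no common end, so a shared vertex is off one of them, hence is [z] or [z']. As
   there are two shared vertices, both [z] and [z'] are shared, and each is an end of the other
   arc. *)
have [zin z'in] : z \in [:: x'; y'] /\ z' \in [:: x; y].
  move: aT0 bT0 aT0' bT0'; rewrite !eT !eT' ![_ \in [:: x; y; z]]split3.
  rewrite ![_ \in [:: x'; y'; z']]split3.
  have off v := @contraTN _ _ (@xy_off v).
  case/orP=> [ain|/eqP aeq]; case/orP=> [bin|/eqP beq].
  - rewrite (negPf (xy_off _ ain)) (negPf (xy_off _ bin)) /= => /eqP az /eqP bz.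
    by rewrite az bz eqxx in ab0.
  - rewrite (negPf (xy_off _ ain)) /= => /eqP az; rewrite -az -beq => /orP[|/eqP ba] //.
    by rewrite ba eqxx in ab0.
  - rewrite (negPf (xy_off _ bin)) /= => h /eqP bz; rewrite -bz -aeq.
    by case/orP: h => [//|/eqP ba]; rewrite ba bz eqxx in ab0.
  - by rewrite aeq beq eqxx in ab0.
have zT : z \in T t by rewrite eT split3 eqxx orbT.
have zT' : z \in T t' by rewrite eT' split3 zin.
have z'T' : z' \in T t' by rewrite eT' split3 eqxx orbT.
have [c [cT' cz cz' echi]] : exists c, [/\ c \in T t', c != z, c != z' &
    forall v, chi (p t') v = (v == z) (+) (v == c)].
  rewrite e2 /chi /=; move: zin; rewrite !inE => /orP[/eqP->|/eqP->].
    by exists y'; rewrite eq_sym xy' eq_sym zy' eT' split3 !inE eqxx orbT; split.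
  by exists x'; rewrite xy' eq_sym zx' eT' split3 !inE eqxx; split=> // v; rewrite addbC.
have tt'neq : t != t' by apply: contraNneq t's => ->; rewrite mem_head.
have [t's' ts] : t' \notin s /\ t \notin s.
  by move: us t's; rewrite /= inE negb_or => /andP[-> _] /andP[_ ->].
pose q d d' := upd (upd p t d) t' d'.
have qt d d' : q d d' t = d by rewrite /q upd_neq // upd_id.
have qt' d d' : q d d' t' = d' by rewrite /q upd_id.
have qs d d' : {in s, p =1 q d d'}.
  move=> e es; rewrite /q !upd_neq //; first by apply: contraNneq ts => <-.
  by apply: contraNneq t's' => <-.
have qadm d d' : d.1 != d.2 -> d.1 \in T t -> d.2 \in T t ->
    d'.1 != d'.2 -> d'.1 \in T t' -> d'.2 \in T t' -> forall e, admissible e (q d d' e).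
  move=> h1 h2 h3 h4 h5 h6; apply: admissible_upd; last by rewrite /admissible tt' h4 h5 h6.
  by apply: admissible_upd => //; rewrite /admissible tt h1 h2 h3.
have qeven d d' : (forall v, chi (p t) v (+) chi (p t') v = chi d v (+) chi d' v) ->
    forall v, odd_deg (q d d') v = false.
  move=> h v; have := h v; rewrite /q !odd_deg_upd upd_neq 1?eq_sym // evp /=.
  by case: (chi (p t) v); case: (chi d v); case: (chi (p t') v); case: (chi d' v).
have us' : uniq s by case/andP: us.
(* If [z'] is the start [x] of the arc of [t], the new trail is [z - y - ... - x - c], with [t]
   first and [t'] last; if it is the end [y], the new trail is [c - y - ... - x - z], with [t']
   first and [t] last. *)
move: z'in; rewrite !inE => /orP[/eqP e3|/eqP e3].
- exists (q (z, y) (x, c)), z, (t :: s ++ [:: t']), c;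
    split; last by rewrite /= size_cat addn1.
  split.
  + by apply: qadm; rewrite //= -e3 // eq_sym.
  + by apply: qeven => v; rewrite echi e1 /chi /=;
    move: (v == z) (v == x) (v == y) (v == c) => [] [] [] [].
  + by rewrite /= mem_cat inE negb_or ts tt'neq cat_uniq us' /= orbF t's'.
  + rewrite /= qt eqxx; apply: (@trail_cat _ _ _ _ _ x).
      by rewrite -(eq_in_trail _ _ (qs _ _)).
    by rewrite /= qt' !eqxx.
- exists (q (x, z) (c, y)), c, (t' :: s ++ [:: t]), z;
    split; last by rewrite /= size_cat addn1.
  split.
  + by apply: qadm; rewrite //= -?e3 // eq_sym.
  + by apply: qeven => v; rewrite echi e1 /chi /=;
    move: (v == z) (v == x) (v == y) (v == c) => [] [] [] [].
  + by rewrite /= mem_cat inE negb_or t's' eq_sym tt'neq cat_uniq us' /= orbF ts.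
  + rewrite /= qt' eqxx; apply: (@trail_cat _ _ _ _ _ x).
      by rewrite -(eq_in_trail _ _ (qs _ _)).
    by rewrite /= qt !eqxx.
Qed.

Lemma even_trail_grow p u s w f e : even_trail p u s w -> f \in s -> e \notin s ->
  exists p' u' s' w', even_trail p' u' s' w' /\ size s' = (size s).+1.
Proof.
move=> st fs es; apply: contrapT => no_longer.
have closed_off p' u' s' : even_trail p' u' s' u' -> size s' = size s ->
    forall x y v, x \in s' -> y \notin s' -> chi (p' x) v -> chi (p' y) v = false.
  move=> st' szs' x y v xs' ys' cx; apply/negbTE/negP => cy; apply: no_longer.
  have [s'' perm st''] := even_trail_rot st' xs'.
  have ys'' : y \notin x :: s'' by rewrite -(perm_mem perm).
  have sz'' : size (x :: s'') = size s by rewrite -(perm_size perm).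
  have grow v' r : even_trail p' v' r v' -> perm_eq r s' -> chi (p' y) v' ->
      exists p' u' s' w', even_trail p' u' s' w' /\ size s' = (size s).+1.
    move=> str pr cy'; have [|p2 [u2 st2]] := even_trail_prepend str _ cy'.
      by rewrite (perm_mem pr).
    by exists p2, u2, (y :: r), v'; rewrite /= (perm_size pr) szs'.
  have [ev|nev] := eqVneq v (p' x).1.
    by apply: (grow _ _ st''); rewrite ?ev -?ev // perm_sym.
  have ev : v = (p' x).2 by move: cx; rewrite /chi (negPf nev) /= => /eqP.
  (* Here [v] is the end of the arc of [x], so the rotation has [x] last instead of first. *)
  apply: (grow v (rcons s'' x)); rewrite ?perm_rcons 1?perm_sym //.
  case: st'' => admp evp us /= /andP[_ tr]; split=> //; first by rewrite rcons_uniq.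
  by rewrite -cats1 ev (trail_cat tr) //= !eqxx.
have wu : w = u.
  apply: (even_trail_closed st) => y ys; apply/negbTE/negP => cy; apply: no_longer.
  have [p2 [u2 st2]] := even_trail_prepend st ys cy.
  by exists p2, u2, (y :: s), w.
subst w.
have off := closed_off _ _ _ st erefl.
have [admp evp us tr] := st.
(* A fixed arc has at its start another arc, by evenness; it belongs to a triangle by [d0_disjoint],
   and by [off] it is used exactly when the fixed arc is. *)
have same_side x : exists2 y, tri y & (y \in s) = (x \in s).
  have [tx|ntx] := boolP (tri x); first by exists x.
  pose v := (p x).1.
  have cx : chi (p x) v by rewrite /chi eqxx (negPf (admissible_neq (admp x))).
  have /existsP[y /andP[yx cy]] : [exists y, (y != x) && chi (p y) v].
    have := evp v; apply: contraFT; rewrite negb_exists => /forallP no.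
    rewrite /odd_deg (bigD1 x) //= cx big1 // => y yx.
    by apply: contraNF (no y) => cy; rewrite yx cy.
  exists y.
    apply: contraNT yx => nty; apply/eqP; apply: (d0_disjoint (v := v)) => //.
      by rewrite -(admissible_chi _ nty (admp y)).
    by rewrite -(admissible_chi _ ntx (admp x)).
  apply/idP/idP => [ys|xs]; apply: contraT => ns.
    by rewrite (off _ _ _ ys ns cy) in cx.
  by rewrite (off _ _ _ xs ns cx) in cy.
have [t1 tt1 t1s] := same_side f; have [t2 tt2 t2s] := same_side e.
rewrite fs in t1s; rewrite (negPf es) in t2s.
have [t [t' [ts t's att']]] :=
  connect_exit (tri_connected tt1 tt2) t1s (negbT t2s).
have [s' perm st'] := even_trail_rot st ts.
apply: no_longer; rewrite (perm_size perm) /=.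
apply: (even_trail_exchange st' _ att') => [|v]; first by rewrite -(perm_mem perm).
exact: off ts t's.
Qed.

(* Doubling a triangle removes the parity obstruction to an Eulerian closed
   trail. *)
Lemma covering_trail t1 t2 : tri t1 -> tri t2 -> t1 != t2 -> T t1 = T t2 ->
  exists p s, [/\ forall e, admissible e (p e), uniq s, s =i E &
     forall e, exists2 s', perm_eq s (e :: s') & trail p (p e).2 s' (p e).1].
Proof.
move=> tt1 tt2 t12 eT.
have [p admp evp] := even_assignment tt1 tt2 t12 eT.
have : exists p u s w, even_trail p u s w /\ 0 < size s.
  by exists p, (p t1).1, [:: t1], (p t1).2; split=> //; split; rewrite //= !eqxx.
case=> {admp evp} {}p [u [s [w [st s_gt0]]]].
have [n] := ubnP (#|E| - size s).
elim: n => // n IH in p u s w st s_gt0 * => lt_n.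
have [/forallP alls|] := boolP [forall e, e \in s].
  have [admp evp us tr] := st.
  have wu : w = u.
    by apply: (even_trail_closed st) => e; rewrite alls.
  subst w; exists p, s; split=> // e.
  have [s' perm [_ _ _ /= /andP[_ h]]] := even_trail_rot st (alls e).
  by exists s'.
rewrite negb_forall => /existsP[e es].
case: s => // f s in st s_gt0 lt_n es *.
have [p' [u' [s' [w' [st' sz']]]]] := even_trail_grow st (mem_head f s) es.
apply: (IH p' u' s' w' st'); first by rewrite sz'.
have lt_s : size (f :: s) < #|E|.
  have [_ _ us _] := st; rewrite -(card_uniqP us); apply: proper_card.
  by apply/properP; split; [exact/fintype.subsetP|exists e].
by rewrite sz'; move: lt_n; rewrite ltnS; apply: leq_trans; rewrite ltn_sub2l.
Qed.

End Triangles.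
End Trails.

(** * Facet paths of tight polyhedra *)

Lemma next_neq (I : eqType) (s : seq I) v : uniq s -> 2 < size s -> v \in s ->
  next s v != v /\ next s v != prev s v.
Proof.
move=> us ss vs; suff [n1 n2] : next s v != v /\ next s (next s v) != v.
  split=> //; apply: contraNneq n2 => ->; exact/eqP/next_prev.
have [i s' rs] := rot_to vs.
rewrite -!(next_rot i us) rs.
have := us; rewrite -(rot_uniq i) rs; have := ss; rewrite -(size_rot i) rs.
case: s' {rs} => [|y [|z l]] //= _; rewrite !inE !negb_or.
case/andP=> /and3P[vy vz _] /andP[/andP[yz _] _].
by rewrite !eqxx [y == v]eq_sym (negPf vy) ?eqxx [z == v]eq_sym vz.
Qed.

Section Polyhedron.
Context (R : realType) (P : polygonal_complex R) (hP : is_polyhedron P).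
Implicit Types (f g h : face P) (v : vertex P) (e : {set vertex P}).

Let walk_uniq f : uniq (face_walk f).
Proof. by have [] := poly_simple hP f. Qed.

Let walk_size f : 2 < size (face_walk f).
Proof. by have [] := poly_simple hP f. Qed.

Lemma edge_walk f e v : e \in edges_of f -> v \in e -> v \in face_walk f.
Proof.
by case/imsetP=> w wf ->; rewrite !inE => /orP[]/eqP->; rewrite ?mem_next.
Qed.

Lemma walk_edge f v : v \in face_walk f ->
  [set v; next (face_walk f) v]%SET \in edges_of f.
Proof. by move=> vf; apply/imsetP; exists v. Qed.

Lemma edges_at f v : v \in face_walk f -> [set e in edges_of f | v \in e]%SET =
  [set [set v; next (face_walk f) v]; [set prev (face_walk f) v; v]]%SET.
Proof.
move=> vf; apply/setP=> e; rewrite !inE; apply/idP/idP.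
  case/andP=> /imsetP[w wf ->]; rewrite !inE => /orP[]/eqP->; rewrite ?eqxx //.
  by rewrite prev_next // eqxx orbT.
case/orP=> /eqP->; rewrite ?walk_edge // !inE eqxx ?orbT // andbT.
by rewrite -{2}[v](next_prev (walk_uniq f)) walk_edge // mem_prev.
Qed.

Lemma edges_at_neq f v : v \in face_walk f ->
  [set v; next (face_walk f) v]%SET != [set prev (face_walk f) v; v]%SET.
Proof.
move=> vf; have [n1 n2] := next_neq (walk_uniq f) (walk_size f) vf.
apply: contraNneq n2 => /setP/(_ (next (face_walk f) v)).
by rewrite !inE eqxx orbT (negPf n1) orbF => /esym.
Qed.

Lemma other_face f e : e \in edges_of f ->
  exists2 g, g != f & [set h | e \in edges_of h]%SET = [set f; g]%SET.
Proof.
move=> ef; have /eqP/cards2P[a [b [ab eab]]] := poly_two_faces hP ef.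
have : f \in [set h | e \in edges_of h]%SET by rewrite inE.
rewrite eab !inE => /orP[]/eqP->; first by exists b => //; rewrite eq_sym.
by exists a; rewrite // finset.setUC.
Qed.

Definition triangle_adjacent f g : bool :=
  [&& triangular f, triangular g & share_edge f g].

Hypothesis hT : tight P.

Lemma nontriangular_eq f g v : ~~ triangular f -> ~~ triangular g ->
  v \in face_walk f -> v \in face_walk g -> f = g.
Proof.
move=> nf ng vf vg; apply/eqP; apply: contraT => fg.
by have := hT fg nf ng v; rewrite vf vg.
Qed.

(** * Connectedness of the triangles of a tight polyhedron *)

Section Component.
Variable t0 : face P.
Hypothesis tt0 : triangular t0.

Let K : {set face P} := [set g | connect triangle_adjacent t0 g]%SET.

Let K_tri g : g \in K -> triangular g.
Proof.
rewrite inE => /connectP[s]; elim/last_ind: s => [_ -> //|s x _].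
by rewrite rcons_path last_rcons => /andP[_ /and3P[_ h _]] ->.
Qed.

Let K_step g h : g \in K -> triangular h -> share_edge g h -> h \in K.
Proof.
move=> gK th gh; have tg := K_tri gK; move: gK; rewrite !inE => gK.
by apply: (connect_trans gK); apply: connect1; rewrite /triangle_adjacent tg th.
Qed.

Let touched e : bool := [exists g in K, e \in edges_of g].

(* Double counting, modulo 2, of the edges at [x] on the faces of the component:
   an edge lying on a single such face lies on [F] as well. *)
Let touched_next F v : ~~ triangular F -> v \in face_walk F ->
  let x := next (face_walk F) v in
  touched [set x; next (face_walk F) x]%SET = touched [set v; x]%SET.
Proof.
move=> nF vF x; have xF : x \in face_walk F by rewrite mem_next.
set e2 := [set x; _]%SET; set e1 := [set v; x]%SET.
have atF : [set e in edges_of F | x \in e]%SET = [set e2; e1]%SET.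
  by rewrite (edges_at xF) prev_next.
have e21 : e2 != e1.
  by have := edges_at_neq xF; rewrite prev_next.
pose N e := \sum_(g in K) (e \in edges_of g).
(* One of the two faces at an edge of [F] is [F] itself, which is not in [K]; so [N e] is 0 or 1. *)
have N_F e : e \in edges_of F -> odd (N e) = touched e.
  move=> eF; have [k kF ek] := other_face eF.
  have kE g : (e \in edges_of g) = (g == F) || (g == k).
    by move/setP/(_ g): ek; rewrite !inE.
  have NF : F \notin K by apply: contra nF; exact: K_tri.
  have [kK|nkK] := boolP (k \in K).
    rewrite /N (bigD1 k) //= kE eqxx orbT big1 => [|g /andP[gK gk]].
      by apply/esym/existsP; exists k; rewrite kK kE eqxx orbT.
    rewrite kE (negPf gk) orbF; case: eqP => // gF.
    by rewrite -gF gK in NF.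
  rewrite /N big1 => [|g gK].
    apply/esym/negbTE; rewrite negb_exists; apply/forallP => g; apply/negP.
    case/andP=> gK; rewrite kE => /orP[]/eqP gE; first by rewrite -gE gK in NF.
    by rewrite -gE gK in nkK.
  rewrite kE; case: eqP => [gE|_ /=]; first by rewrite -gE gK in NF.
  by case: eqP => // gE; rewrite -gE gK in nkK.
(* At any other edge through [x], if one face is in [K] then the second is a triangle by tightness,
   hence in [K] too; so [N e] is 0 or 2. *)
have N_out e : x \in e -> e \notin edges_of F -> odd (N e) = false.
  move=> xe neF; have [/existsP[g /andP[gK eg]]|no] := boolP (touched e); last first.
    rewrite /N big1 // => g gK; apply/eqP; rewrite eqb0.
    by apply: contra no => eg; apply/existsP; exists g; rewrite gK.
  have [k kg ek] := other_face eg.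
  have kE h : (e \in edges_of h) = (h == g) || (h == k).
    by move/setP/(_ h): ek; rewrite !inE.
  have ekk : e \in edges_of k by rewrite kE eqxx orbT.
  have tk : triangular k.
    apply: contraT => nk; have kF := nontriangular_eq nk nF (edge_walk ekk xe) xF.
    by rewrite -kF ekk in neF.
  have kK : k \in K.
    by apply: (K_step gK tk); apply/existsP; exists e; rewrite eg.
  rewrite /N (bigD1 g) //= (bigD1 k) /=; last by rewrite kK.
  rewrite big1 ?eg ?ekk // => h /andP[/andP[_ hg] hk].
  by rewrite kE (negPf hg) (negPf hk).
(* Summed face by face instead, each face of [K] has two edges at [x] or none. *)
have : odd (\sum_(e : {set vertex P} | x \in e) N e) = false.
  rewrite exchange_big /= (big_morph odd oddD (erefl _)) big1 // => g _.
  rewrite -big_mkcondr /= sum1_card.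
  have [xg|nxg] := boolP (x \in face_walk g).
    have := cards2 [set x; next (face_walk g) x]%SET [set prev (face_walk g) x; x]%SET.
    rewrite -edges_at // edges_at_neq // => h.
    rewrite (_ : #|_| = 2) // -h; apply: eq_card => e.
    by rewrite !inE andbC.
  rewrite eq_card0 // => e; rewrite !inE; apply/negbTE/negP => /andP[xe eg].
  by rewrite (edge_walk eg xe) in nxg.
have mem_at e : (e \in edges_of F) && (x \in e) = (e == e2) || (e == e1).
  by move/setP/(_ e): atF; rewrite !inE.
have /andP[e2F xe2] : (e2 \in edges_of F) && (x \in e2) by rewrite mem_at eqxx.
have /andP[e1F xe1] : (e1 \in edges_of F) && (x \in e1) by rewrite mem_at eqxx orbT.
rewrite (bigD1 e2) //= (bigD1 e1) /=; last by rewrite xe1 eq_sym.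
rewrite !oddD !N_F // (big_morph odd oddD (erefl _)) big1 => [|e].
  by rewrite addbF; case: touched; case: touched.
case/andP=> /andP[xe ne2] ne1; apply: N_out => //; apply/negP => eF.
by have := mem_at e; rewrite eF xe (negPf ne2) (negPf ne1).
Qed.

(** [touched_next] carries the property once around the boundary of [F]. *)
Let touched_all F e e' : ~~ triangular F -> e \in edges_of F -> e' \in edges_of F ->
  touched e -> touched e'.
Proof.
move=> nF /imsetP[v vF ->] /imsetP[w wF ->].
pose S := [pred v | touched [set v; next (face_walk F) v]%SET].
have cl : fclosed (next (face_walk F)) S.
  move=> x y /eqP <-; rewrite !inE; have [xF|nxF] := boolP (x \in face_walk F).
    by rewrite -touched_next.
  have xE : next (face_walk F) x = x by rewrite next_nth (negPf nxF).
  by rewrite !xE.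
have := fconnect_cycle (cycle_next (walk_uniq F)) vF w; rewrite wF => vw.
by have := closed_connect cl vw; rewrite !inE => <-.
Qed.

(** A chain of faces from [t0] to [t] may cross other faces than triangles. By [touched_all], such a
    face entered from [K] has triangles of [K] across all its edges, so the chain can only leave it
    into [K] again; [K'] is this invariant. *)
Lemma triangle_connect t : triangular t -> connect triangle_adjacent t0 t.
Proof.
move=> tt; suff tK : t \in K by move: tK; rewrite inE.
pose K' g := (g \in K) || ~~ triangular g && [forall e in edges_of g, touched e].
suff : K' t by rewrite /K' tt orbF.
have t0K : K' t0 by rewrite /K' inE connect0.
have /connectP[s] := poly_connected hP t0 t.
elim: s (t0) t0K => [|h s IH] g gK /=; first by move=> _ ->.
case/andP=> /existsP[e /andP[eg eh]] ps tl; apply: IH ps tl; rewrite /K'.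
case/orP: gK => [gK|/andP[ng /forall_inP all_g]].
  have [th|nh] := boolP (triangular h).
    by rewrite (K_step gK th) //; apply/existsP; exists e; rewrite eg.
  rewrite /= orbC; apply/orP; left; apply/forall_inP => e' e'h.
  by apply: (touched_all nh eh e'h); apply/existsP; exists g; rewrite gK.
have [->|hg] := eqVneq h g.
  by rewrite ng /= orbC; apply/orP; left; apply/forall_inP.
have /existsP[k /andP[kK ek]] := all_g _ eg.
have [k' k'g ek'] := other_face eg.
have kE x : (e \in edges_of x) = (x == g) || (x == k').
  by move/setP/(_ x): ek'; rewrite !inE.
move: eh ek; rewrite !kE (negPf hg) /= => /eqP-> /orP[/eqP kg|/eqP<-]; last by rewrite kK.
by have := K_tri kK; rewrite kg (negPf ng).
Qed.

End Component.

(** By tightness, a neighbour of a non-triangular face across an edge is a triangle. *)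
Lemma triangle_exists : exists t : face P, triangular t.
Proof.
have [f _] := poly_nonempty hP; have [tf|nf] := boolP (triangular f); first by exists f.
have /hasP[v vf _] : has predT (face_walk f).
  by rewrite has_predT (leq_trans _ (walk_size f)).
have ef := walk_edge vf; have [g gf eg] := other_face ef; exists g.
have gE : [set v; next (face_walk f) v]%SET \in edges_of g.
  by move/setP/(_ g): eg; rewrite !inE eqxx orbT.
apply: contraNT gf => ng; apply/eqP/(nontriangular_eq ng nf _ vf).
by apply: edge_walk gE _; rewrite !inE eqxx.
Qed.

Lemma facet_path (d0 : face P -> vertex P * vertex P) :
  (forall f, ~~ triangular f ->
    [/\ (d0 f).1 != (d0 f).2, (d0 f).1 \in face_walk f & (d0 f).2 \in face_walk f]) ->
  exists p s, [/\ forall f, admissible (@triangular R P) (@face_walk R P) d0 f (p f),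
    uniq s, s =i face P & sorted (fun f g => (p f).2 == (p g).1) s].
Proof.
move=> hd; have [t1 tt1] := triangle_exists.
(* [None] is a second copy of the triangle [t1]. *)
pose unopt : option (face P) -> face P := odflt t1.
have chi_walk f v : ~~ triangular f -> chi (d0 f) v -> v \in face_walk f.
  by move=> /hd[_ h1 h2]; rewrite /chi; case: eqP => [->//|_]; case: eqP => [->|].
pose tri o := triangular (unopt o); pose T o := face_walk (unopt o).
have adj x y : tri x -> tri y -> share_edge (unopt x) (unopt y) -> edge_adjacent tri T x y.
  move=> tx ty /existsP[e /andP[ex ey]]; apply/and3P; split=> //.
  case/imsetP: (ex) => v vx eE; have [vn _] := next_neq (walk_uniq _) (walk_size _) vx.
  apply/existsP; exists v; apply/existsP; exists (next (face_walk (unopt x)) v).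
  rewrite eq_sym vn !(edge_walk ex) ?(edge_walk ey) // eE !inE eqxx ?orbT //.
have share_refl f : share_edge f f.
  have /hasP[v vf _] : has predT (face_walk f).
    by rewrite has_predT (leq_trans _ (walk_size f)).
  by apply/existsP; exists [set v; next (face_walk f) v]%SET; rewrite walk_edge.
have [||||| p [s [admp us sE hs]]] := @covering_trail (vertex P) (option (face P))
  tri T (fun o => d0 (unopt o)) _ _ _ _ _ (Some t1) None tt1 tt1 isT (erefl _).
- by move=> o /eqP to; split=> //; exact: walk_uniq.
- by move=> o /hd[].
- move=> o o' v no no' /(chi_walk _ _ no) vo /(chi_walk _ _ no') vo'.
  have := nontriangular_eq no no' vo vo'.
  case: o no {vo} => [f|] no; last by rewrite /tri /= tt1 in no.
  by case: o' no' {vo'} => [g|] no' /= => [->|]; last by rewrite /tri /= tt1 in no'.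
- move=> o v no /(chi_walk _ _ no) vo.
  have [g gf eg] := other_face (walk_edge vo); exists (Some g); rewrite /tri /T /=.
    have gE : [set v; next (face_walk (unopt o)) v]%SET \in edges_of g.
      by move/setP/(_ g): eg; rewrite !inE eqxx orbT.
    apply: contraNT gf => ng; apply/eqP/(nontriangular_eq ng no _ vo).
    by apply: edge_walk gE _; rewrite !inE eqxx.
  have gE : [set v; next (face_walk (unopt o)) v]%SET \in edges_of g.
    by move/setP/(_ g): eg; rewrite !inE eqxx orbT.
  by apply: edge_walk gE _; rewrite !inE eqxx.
(* Each copy is adjacent to the original face, so only paths between originals have to be lifted. *)
- move=> o o' to to'; apply: (@connect_trans _ _ (Some (unopt o))).
    exact/connect1/adj.
  apply: (@connect_trans _ _ (Some (unopt o'))); last exact/connect1/adj.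
  have /connectP[l] := triangle_connect to to'.
  elim: l (unopt o) => [|f l IH] g /=; first by move=> _ ->.
  case/andP=> /and3P[tg tf gf] pl el; apply: connect_trans (IH f pl el).
  exact/connect1/adj.
(* The closed trail is cut open at the copy [None]; the rest is a trail through each face once. *)
have [s' perm tr] := hs None.
have s'E : s' = map Some (pmap id s').
  have : None \notin s' by have := us; rewrite (perm_uniq perm) => /andP[].
  by elim: s' {perm tr} => //= -[f|] l IH; rewrite inE //= => /IH {1}->.
exists (p \o Some), (pmap id s'); split.
- by move=> f; exact: admp (Some f).
- have := us; rewrite (perm_uniq perm) /= => /andP[_]; rewrite {1}s'E map_inj_uniq //.
- move=> f; have -> : (f \in pmap id s') = (Some f \in s').
    by rewrite [in RHS]s'E mem_map // => ? ? [].
  by have := sE (Some f); rewrite (perm_mem perm) in_cons.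
- have := trail_sorted tr; rewrite {1}s'E sorted_map; exact.
Qed.

End Polyhedron.

(** * Extreme vertices and strips *)

Import Order.TTheory GRing.Theory Num.Theory.
Import numFieldNormedType.Exports.
Local Open Scope classical_set_scope.
Local Open Scope ring_scope.

(** * Dot products, cross products and plane coordinates *)

Section DotProduct.
Context (R : realType).

Lemma dotpC n (u v : 'rV[R]_n) : dotp u v = dotp v u.
Proof. by apply: eq_bigr => i _; rewrite mulrC. Qed.

Lemma dotpDr n (u v w : 'rV[R]_n) : dotp u (v + w) = dotp u v + dotp u w.
Proof. by rewrite -big_split; apply: eq_bigr => i _; rewrite mxE mulrDr. Qed.

Lemma dotpZr n a (u v : 'rV[R]_n) : dotp u (a *: v) = a * dotp u v.
Proof. by rewrite mulr_sumr; apply: eq_bigr => i _; rewrite mxE mulrCA. Qed.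

Lemma dotpNr n (u v : 'rV[R]_n) : dotp u (- v) = - dotp u v.
Proof. by rewrite -scaleN1r dotpZr mulN1r. Qed.

Lemma dotpNl n (u v : 'rV[R]_n) : dotp (- u) v = - dotp u v.
Proof. by rewrite dotpC dotpNr dotpC. Qed.

Lemma dotpBr n (u v w : 'rV[R]_n) : dotp u (v - w) = dotp u v - dotp u w.
Proof. by rewrite dotpDr dotpNr. Qed.

Lemma dotp_gt0 n (u : 'rV[R]_n) : u != 0 -> 0 < dotp u u.
Proof.
move=> u0; rewrite lt_def sumr_ge0 ?andbT => [|i _]; last by rewrite -expr2 sqr_ge0.
apply: contraNneq u0 => /psumr_eq0P uu; apply/eqP/rowP => i; rewrite mxE.
by apply/eqP; rewrite -sqrf_eq0 expr2 uu // => j _; rewrite -expr2 sqr_ge0.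
Qed.

Definition coord (u : 'rV[R]_3) (k : nat) : R := u ord0 (inord k).

Lemma dotpE (u v : 'rV[R]_3) :
  dotp u v = coord u 0 * coord v 0 + coord u 1 * coord v 1 + coord u 2 * coord v 2.
Proof.
rewrite /dotp !big_ord_recr big_ord0 /= add0r /coord.
by congr (_ * _ + _ * _ + _ * _); congr (_ _ _); apply: val_inj; rewrite /= inordK.
Qed.

Definition cross (u v : 'rV[R]_3) : 'rV[R]_3 := \row_(i < 3)
  nth 0 [:: coord u 1 * coord v 2 - coord u 2 * coord v 1;
            coord u 2 * coord v 0 - coord u 0 * coord v 2;
            coord u 0 * coord v 1 - coord u 1 * coord v 0] i.

Lemma coord_cross u v :
  [/\ coord (cross u v) 0 = coord u 1 * coord v 2 - coord u 2 * coord v 1,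
      coord (cross u v) 1 = coord u 2 * coord v 0 - coord u 0 * coord v 2 &
      coord (cross u v) 2 = coord u 0 * coord v 1 - coord u 1 * coord v 0].
Proof. by rewrite /coord !mxE !inordK. Qed.

Lemma dotp_crossl u v : dotp u (cross u v) = 0.
Proof. by rewrite dotpE; case: (coord_cross u v) => -> -> ->; ring. Qed.

Lemma dotp_crossr u v : dotp v (cross u v) = 0.
Proof. by rewrite dotpE; case: (coord_cross u v) => -> -> ->; ring. Qed.

Lemma cross_sqr u v : dotp (cross u v) (cross u v) =
  dotp u u * dotp v v - dotp u v ^+ 2.
Proof. by rewrite !dotpE; case: (coord_cross u v) => -> -> ->; ring. Qed.

(* Gram determinant of [u], [v], [w] *)
Lemma dotp_cross_sqr u v w : dotp (cross u v) w ^+ 2 =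
  dotp u u * dotp v v * dotp w w + 2 * (dotp u v * dotp v w * dotp u w)
  - dotp u u * dotp v w ^+ 2 - dotp v v * dotp u w ^+ 2 - dotp w w * dotp u v ^+ 2.
Proof. by rewrite !dotpE; case: (coord_cross u v) => -> -> ->; ring. Qed.

Lemma cross_neq0 u v : u != 0 -> v != 0 -> dotp u v = 0 -> cross u v != 0.
Proof.
move=> u0 v0 uv; apply: contraTneq (mulr_gt0 (dotp_gt0 u0) (dotp_gt0 v0)) => c0.
have := cross_sqr u v; rewrite c0 uv expr0n subr0 => <-.
by rewrite /dotp big1 ?ltxx // => i _; rewrite mxE mul0r.
Qed.

(* Orthonormal coordinates, the first one along [u], on the planes normal to [n]. *)
Definition plane_coords (n u x : 'rV[R]_3) : 'rV[R]_2 := \row_(i < 2)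
  (if i == ord0 then dotp u x / Num.sqrt (dotp u u)
   else dotp (cross n u) x / Num.sqrt (dotp n n * dotp u u)).

(** Let [d] be [x - y], orthogonal to [n]. The Gram determinant of [n], [u], [d] reduces to |n|^2
    (|u|^2 |d|^2 - (u . d)^2). Divided by |n|^2 |u|^2, it is the square of the second coordinate of
    [d], and adding that of the first leaves |d|^2. *)
Lemma plane_coords_isometry (n u x y : 'rV[R]_3) : n != 0 -> u != 0 -> dotp n u = 0 ->
  dotp n x = dotp n y ->
  Defs.edist (plane_coords n u x) (plane_coords n u y) = Defs.edist x y.
Proof.
move=> n0 u0 nu nxy; congr (Num.sqrt _).
have nd : dotp n (x - y) = 0 by rewrite dotpBr nxy subrr.
have nn := dotp_gt0 n0; have uu := dotp_gt0 u0.
set d := dotp (x - y) _; rewrite [LHS]/dotp !big_ord_recr big_ord0 /= add0r !mxE /=.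
rewrite -!mulrBl -!dotpBr -!expr2 !exprMn !exprVn !sqr_sqrtr ?mulr_ge0 ?ltW //.
rewrite dotp_cross_sqr nu nd -/d; field.
by rewrite !gt_eqF.
Qed.

Lemma plane_coords0 n u x :
  plane_coords n u x ord0 ord0 = dotp u x / Num.sqrt (dotp u u).
Proof. by rewrite mxE eqxx. Qed.

(** A common interior point has first coordinate at least [a] because of [B], but a small shift to
    the right would keep it in [A]. *)
Lemma interior_halfplanes n (a : R) (A B : set 'rV[R]_n.+1) :
  (forall x, A x -> x ord0 ord0 <= a) -> (forall x, B x -> a <= x ord0 ord0) ->
  interior A `&` interior B = set0.
Proof.
move=> hA hB; rewrite -interiorI; apply/seteqP; split=> // x /nbhs_ballP[e /= e0 he].
(* Dividing by 1 + |d| makes [c *: d] shorter than [e]. *)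
pose d : 'rV[R]_n.+1 := delta_mx ord0 ord0; pose c := e / (1 + `|d|).
have d1 : 0 < 1 + `|d| by rewrite ltr_wpDr.
have c0 : 0 < c by rewrite divr_gt0.
have eq_ball : ball x e (x + c *: d).
  rewrite -ball_normE /= opprD addrA subrr sub0r normrN normrZ gtr0_norm //.
  by rewrite mulrAC ltr_pdivrMr // ltr_pM2l // ltrDr.
have [/hA + _] := he _ eq_ball; have [_ /hB xB] := he _ (ballxx x e0).
by rewrite !mxE !eqxx mulr1 => ya; lra.
Qed.

End DotProduct.

(** * Extreme vertices and the strip containing a face *)

Section Strips.
Context (R : realType) (P : polygonal_complex R) (hP : is_polyhedron P).
Implicit Types (f g : face P) (a b v : vertex P) (u : 'rV[R]_3).

Lemma face_boundary_plane f : face_boundary f `<=` face_plane f.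
Proof.
move=> x [e ef [v [w [eE [t _ ->]]]]].
have vf : v \in face_walk f by apply: (edge_walk ef); rewrite eE !inE eqxx.
have wf : w \in face_walk f by apply: (edge_walk ef); rewrite eE !inE eqxx orbT.
rewrite /face_plane /= dotpDr !dotpZr (poly_planar hP vf) (poly_planar hP wf).
by rewrite mulrBl mul1r subrK.
Qed.

Lemma face_region_plane f : face_region f `<=` face_plane f.
Proof. by move=> x [/face_boundary_plane|[[]]]. Qed.

Lemma face_boundary_le f u m :
  (forall v, v \in face_walk f -> dotp u (pos v) <= m) ->
  forall x, face_boundary f x -> dotp u x <= m.
Proof.
move=> hm x [e ef [v [w [eE [t /andP[t0 t1] ->]]]]].
have vf : v \in face_walk f by apply: (edge_walk ef); rewrite eE !inE eqxx.
have wf : w \in face_walk f by apply: (edge_walk ef); rewrite eE !inE eqxx orbT.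
rewrite dotpDr !dotpZr; have := hm v vf; have := hm w wf.
by move: (dotp u _) (dotp u _) => q p; nra.
Qed.

(* Beyond [m] the ray in direction [u] stays off the boundary, so it lies in one
   unbounded component. *)
Lemma face_region_le f u m : u != 0 -> dotp (face_normal f) u = 0 ->
  (forall v, v \in face_walk f -> dotp u (pos v) <= m) ->
  forall x, face_region f x -> dotp u x <= m.
Proof.
move=> u0 nu hm x [/(face_boundary_le hm)//|[[xf xb] bd]].
rewrite leNgt; apply/negP => mx.
pose r (t : R) := x + t *: u; pose A := r @` `[0, +oo[.
have Asub : A `<=` face_plane f `\` face_boundary f.
  move=> _ [t /= + <-]; rewrite in_itv /= andbT => t0; split.
    by rewrite /face_plane /= dotpDr dotpZr nu mulr0 addr0.
  move=> /(face_boundary_le hm); rewrite dotpDr dotpZr leNgt => /negP; apply.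
  by rewrite ltr_wpDr // mulr_ge0 // ltW // dotp_gt0.
have Ax : A x by exists 0; rewrite /= ?in_itv /= ?lexx // /r scale0r addr0.
have Aconn : connected A.
  apply: connected_continuous_connected.
    exact/connected_intervalP/interval_is_interval.
  apply: continuous_subspaceT => t; apply: cvgD; first exact: cvg_cst.
  exact: scalel_continuous.
have [M [_ hM]] := bd.
have nu0 : 0 < `|u| by rewrite normr_gt0.
(* Points of the component have norm at most [N], since [N] exceeds [M]; but [t] is chosen so that
   |t u| = N + |x| + 1, which puts [r t] at norm at least N + 1. *)
pose N := `|M| + 1; pose t := (N + `|x| + 1) / `|u|.
have t0 : 0 <= t by rewrite divr_ge0 // !addr_ge0.
have rA : A (r t) by exists t; rewrite //= in_itv /= t0.
have ltMN : M < N by rewrite (le_lt_trans (ler_norm M)) // ltrDl.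
have := hM N ltMN _ (connected_component_max Ax Asub Aconn rA).
have tu : `|t *: u| = N + `|x| + 1 by rewrite normrZ ger0_norm // divfK ?gt_eqF.
have := ler_normB (r t) x; rewrite /r addrAC subrr add0r tu /= => h1 h2.
by lra.
Qed.

(** Antipodal pairs in the sense of convex geometry: two parallel lines of the plane of [f], normal
    to [u], pass through [a] and [b] and enclose the face between them. *)
Definition antipodal f a b : Prop := exists u,
  [/\ u != 0, dotp (face_normal f) u = 0 & forall v, v \in face_walk f ->
      dotp u (pos a) <= dotp u (pos v) <= dotp u (pos b)].

Lemma antipodal_sym f a b : antipodal f a b -> antipodal f b a.
Proof.
case=> u [u0 nu hu]; exists (- u); split; rewrite ?oppr_eq0 ?dotpNr ?nu ?oppr0 //.
by move=> v /hu /andP[h1 h2]; rewrite !dotpNl !lerN2 h1 h2.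
Qed.

Lemma planar_diff f v w : v \in face_walk f -> w \in face_walk f ->
  dotp (face_normal f) (pos v - pos w) = 0.
Proof.
by move=> vf wf; rewrite dotpBr (poly_planar hP vf) (poly_planar hP wf) subrr.
Qed.

Lemma pos_diff_neq0 v w : v != w -> pos v - pos w != 0.
Proof. by move=> vw; rewrite subr_eq0 (inj_eq (poly_pos_inj hP)). Qed.

(** The line through [a] and the third vertex [c] supports the triangle, so its normal in the plane,
    with the right sign, is a suitable direction. *)
Lemma antipodal_triangle f a b : triangular f -> a != b ->
  a \in face_walk f -> b \in face_walk f -> antipodal f a b.
Proof.
move=> tf ab af bf.
have [c [ca cb wE]] : exists c, [/\ c != a, c != b & face_walk f =i [:: a; b; c]].
  apply: (@exists_third _ _ (@triangular R P) (@face_walk R P)) => // g /eqP sg.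
  by split=> //; have [] := poly_simple hP g.
have cf : c \in face_walk f by rewrite wE !inE eqxx !orbT.
have n0 := poly_normal_neq0 hP f.
pose u := cross (face_normal f) (pos c - pos a).
have u0 : u != 0 by rewrite cross_neq0 ?pos_diff_neq0 ?planar_diff.
have nu : dotp (face_normal f) u = 0 by exact: dotp_crossl.
have uca : dotp u (pos c) = dotp u (pos a).
  by apply/eqP; rewrite -subr_eq0 -dotpBr dotpC dotp_crossr.
have key w : w != 0 -> dotp (face_normal f) w = 0 -> dotp w (pos c) = dotp w (pos a) ->
    dotp w (pos a) <= dotp w (pos b) -> antipodal f a b.
  move=> w0 nw wca wab; exists w; split=> // v; rewrite wE !inE.
  by case/or3P=> /eqP->; rewrite ?wca lexx ?wab.
have [uab|uba] := leP (dotp u (pos a)) (dotp u (pos b)); first exact: (key u).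
apply: (key (- u)); rewrite ?oppr_eq0 ?dotpNr ?nu ?oppr0 //.
  by rewrite !dotpNl uca.
by rewrite !dotpNl lerN2 ltW.
Qed.

(** Minimize and maximize along the direction of an edge: the two ends of that edge have different
    values, so the extreme vertices differ. *)
Lemma antipodal_exists f : exists d : vertex P * vertex P,
  [/\ d.1 != d.2, d.1 \in face_walk f, d.2 \in face_walk f & antipodal f d.1 d.2].
Proof.
have [us ss _] := poly_simple hP f.
have /hasP[v vf _] : has predT (face_walk f) by rewrite has_predT (leq_trans _ ss).
pose w := next (face_walk f) v.
have [wv _] := next_neq us ss vf; have wf : w \in face_walk f by rewrite mem_next.
pose u := pos w - pos v; pose F (x : vertex P) := dotp u (pos x).
have u0 : u != 0 by exact: pos_diff_neq0.
exists ([arg min_(x < v in face_walk f) F x]%O, [arg max_(x > v in face_walk f) F x]%O).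
case: arg_minP => //= a af ha; case: arg_maxP => //= b bf hb.
have ltF : F v < F w by rewrite -subr_gt0 /F -dotpBr dotp_gt0.
split=> //; last first.
  by exists u; split; rewrite ?planar_diff // => x xf; rewrite ha //=; exact: hb.
apply: contraTneq ltF => ab; rewrite -leNgt.
by apply: le_trans (ha _ vf); rewrite ab; exact: hb.
Qed.

(** Plane coordinates with first axis along the direction [u] of [antipodal]; [face_region_le] for
    [u] and for [- u] bounds the whole region. *)
Lemma strip_placement f a b : antipodal f a b ->
  exists phi : 'rV[R]_3 -> 'rV[R]_2,
    (forall x y, face_region f x -> face_region f y ->
       Defs.edist (phi x) (phi y) = Defs.edist x y) /\
    (forall x, face_region f x ->
       phi (pos a) ord0 ord0 <= phi x ord0 ord0 <= phi (pos b) ord0 ord0).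
Proof.
case=> u [u0 nu hu]; exists (plane_coords (face_normal f) u); split=> [x y|x].
  move=> /face_region_plane xf /face_region_plane yf.
  by apply: plane_coords_isometry => //; [exact: poly_normal_neq0|rewrite xf yf].
move=> xf; rewrite !plane_coords0 !ler_pM2r ?invr_gt0 ?sqrtr_gt0 ?dotp_gt0 //.
apply/andP; split; last first.
  by apply: (face_region_le u0 nu) xf => v /hu /andP[].
rewrite -lerN2 -dotpNl.
apply: (@face_region_le f) xf; rewrite ?oppr_eq0 ?dotpNr ?nu ?oppr0 // => v /hu /andP[h _].
by rewrite dotpNl lerN2.
Qed.

End Strips.

(** * Layout *)

Section Layout.
Context (R : realType) (P : polygonal_complex R) (hP : is_polyhedron P).

Lemma edist_translate n (x y c : 'rV[R]_n) : Defs.edist (x + c) (y + c) = Defs.edist x y.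
Proof. by rewrite /Defs.edist opprD addrACA subrr addr0. Qed.

Lemma vertex_in_region (f : face P) (v : vertex P) :
  v \in face_walk f -> face_region f (pos v).
Proof.
move=> vf; left; exists [set v; next (face_walk f) v]%SET; first exact: walk_edge.
exists v, (next (face_walk f) v); split=> //; exists 0; first by rewrite lexx ler01.
by rewrite subr0 scale1r scale0r addr0.
Qed.

Lemma strip_unfolding (p : face P -> vertex P * vertex P) (s : seq (face P)) :
  (forall f, [/\ (p f).1 \in face_walk f, (p f).2 \in face_walk f &
                 antipodal f (p f).1 (p f).2]) ->
  uniq s -> s =i face P -> sorted (fun f g => (p f).2 == (p g).1) s ->
  has_vertex_unfolding P.
Proof.
move=> hp us sE ss; have [f0 _] := poly_nonempty hP.
have /choice[phi hphi] : forall f, exists phi : 'rV[R]_3 -> 'rV[R]_2,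
    (forall x y, face_region f x -> face_region f y ->
       Defs.edist (phi x) (phi y) = Defs.edist x y) /\
    (forall x, face_region f x -> phi (pos (p f).1) ord0 ord0 <= phi x ord0 ord0
       <= phi (pos (p f).2) ord0 ord0).
  by move=> f; have [_ _ /(strip_placement hP)] := hp f.
pose start f := phi f (pos (p f).1); pose stop f := phi f (pos (p f).2).
(* [D i] is the joint at which the face of index [i] starts and the preceding one stops, the first
   joint being the origin. *)
pose D i := \sum_(j < i) (stop (nth f0 s j) - start (nth f0 s j)).
have DS i : D i.+1 = D i + (stop (nth f0 s i) - start (nth f0 s i)).
  by rewrite /D big_ord_recr.
have fs f : f \in s by rewrite sE.
pose psi f x := phi f x + (D (index f s) - start f).
have psi_start f : psi f (pos (p f).1) = D (index f s).
  by rewrite /psi addrC subrK.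
have psi_stop f : psi f (pos (p f).2) = D (index f s).+1.
  by rewrite DS nth_index // addrCA.
have psi_strip f x : face_region f x ->
    D (index f s) ord0 ord0 <= psi f x ord0 ord0 <= D (index f s).+1 ord0 ord0.
  by move=> /(proj2 (hphi f)); rewrite -psi_start -psi_stop !mxE !lerD2r.
(* Each strip has non-negative width, as the second vertex of a face lies in its own strip. *)
have D_mono i j : (i <= j)%N -> D i ord0 ord0 <= D j ord0 ord0.
  move=> /subnK <-; elim: (j - i)%N => [|k IH] //; apply: le_trans IH _.
  rewrite addSn DS [leRHS]mxE lerDl !mxE subr_ge0.
  set f := nth _ _ _; have [_ v2 _] := hp f.
  by have /andP[] := proj2 (hphi f) _ (vertex_in_region v2).
exists psi; split.
- by move=> f x y xf yf; rewrite edist_translate (proj1 (hphi f)).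
- move=> f g; wlog : f g / (index f s < index g s)%N => [wl fg|fg _].
    have : index f s != index g s.
      by apply: contraNneq fg => e; rewrite -(nth_index f0 (fs f)) e nth_index.
    rewrite neq_ltn => /orP[] lt_fg; first exact: wl.
    by rewrite setIC wl // eq_sym.
  (* The vertical line through the starting joint of [g] separates the two images. *)
  apply: (@interior_halfplanes _ _ (D (index g s) ord0 ord0)) => _ [x xf <-].
    by have /andP[_ /le_trans] := psi_strip _ _ xf; apply; exact: D_mono.
  by have /andP[] := psi_strip _ _ xf.
- set r := (X in connect X); have r_sym : connect_sym r.
    apply: sym_connect_sym => f g; apply/asboolP/asboolP.
      by case=> [[e [? ? h]]|[v [? ? h]]]; [left; exists e|right; exists v]; split=> // x /h.
    by case=> [[e [? ? h]]|[v [? ? h]]]; [left; exists e|right; exists v]; split=> // x /h.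
  suff reach i : (i < size s)%N -> connect r (nth f0 s 0) (nth f0 s i).
    move=> f g; apply: (@connect_trans _ _ (nth f0 s 0)).
      by rewrite r_sym -[f in connect _ _ f](nth_index f0 (fs f)) reach // index_mem.
    by rewrite -[g](nth_index f0 (fs g)) reach // index_mem.
  elim: i => [|i IH] lt_i; first exact: connect0.
  apply: connect_trans (IH (ltnW lt_i)) (connect1 _); apply/asboolP; right.
  set f := nth f0 s i; set g := nth f0 s i.+1.
  have e : (p f).2 = (p g).1 by apply/eqP; exact: (sortedP f0 ss).
  exists (p f).2; split; first by have [] := hp f.
    by rewrite e; have [] := hp g.
  by rewrite psi_stop e psi_start /f /g !index_uniq // ltnW.
Qed.

End Layout.

Theorem theorem2 (R : realType) (P : polygonal_complex R)
  (hP : is_polyhedron P) (hT : tight P) : has_vertex_unfolding P.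
Proof.
have /choice[d hd] := antipodal_exists hP.
have [f _|p [s [admp us sE ss]]] := facet_path hP hT (d0 := d).
  by have [] := hd f.
apply: (strip_unfolding hP _ us sE ss) => f.
have := admp f; rewrite /admissible; case: ifP => [tf /and3P[ab af bf]|_].
  by split=> //; exact: antipodal_triangle.
have [_ h1 h2 h3] := hd f.
(* The trail may traverse the fixed pair in either direction. *)
by case/orP=> /eqP->; split=> //; exact: antipodal_sym.
Qed.
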